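(* Normed algebras and vector spaces with cross products are related as follows. (i) If $W$ is a normed algebra, then $V:=1^\perp$ is equipped with a cross product $V\times V\to V$, $(u,v)\mapsto u\times v$, defined by $$u\times v:=uv+\langle u,v\rangle\qquad\text{for }u,v\in 1^\perp.$$ (ii) If $V$ is a finite dimensional real Hilbert space equipped with a cross product, then $W:=\mathbb{R}\oplus V$ is a normed algebra with $$uv:=u_0v_0-\langle u_1,v_1\rangle+u_0v_1+v_0u_1+u_1\times v_1$$ for $u=u_0+u_1$, $v=v_0+v_1\in\mathbb{R}\oplus V$. Here a real number $\lambda$ is identified with the pair $(\lambda,0)\in\mathbb{R}\oplus V$ and a vector $v\in V$ with the pair $(0,v)\in\mathbb{R}\oplus V$. These constructions are inverses of each other. In particular, a normed algebra has dimension $1$, $2$, $4$, or $8$ and is isomorphic to $\mathbb{R}$, $\mathbb{C}$, $\mathbb{H}$, or $\mathbb{O}$ (the reals, the complex numbers, the quaternions, or the octonions).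
   Context: A normed algebra consists of a finite dimensional real Hilbert space $W$, a bilinear map $W\times W\to W$, $(u,v)\mapsto uv$ (the product, not assumed associative or commutative), and a unit vector $1\in W$ (the unit), satisfying $1u=u1=u$ and $|uv|=|u||v|$ for all $u,v\in W$. The real numbers are identified with a subspace of $W$ via multiplication with the unit $1$, so for $u\in W$ and $\lambda\in\mathbb{R}$ one writes $u+\lambda$ for $u+\lambda1$. A cross product on a finite dimensional real Hilbert space $V$ is a skew-symmetric bilinear map $V\times V\to V$, $(u,v)\mapsto u\times v$, satisfying $\langle u\times v,u\rangle=\langle u\times v,v\rangle=0$ and $|u\times v|^2=|u|^2|v|^2-\langle u,v\rangle^2$ for all $u,v\in V$. *)

(* Defs.v *)
From HB Require Import structures.
From mathcomp Require Import all_boot all_order all_algebra all_reals.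
From mathcomp Require Import sesquilinear complex.

Set Implicit Arguments.
Unset Strict Implicit.
Unset Printing Implicit Defensive.

Import Order.TTheory GRing.Theory Num.Theory.
Local Open Scope ring_scope.

(* A finite dimensional real Hilbert space is [V : vectType R] with
   [ip : {dot V for idfun}], for [R : realType]; dimension 0 is allowed. *)

Section HilbertSpaces.
Variable R : realType.

Definition hilbert_norm (V : vectType R) (ip : {dot V for idfun}) (u : V) : R :=
  Num.sqrt (ip u u).

Definition orthogonal_complement (V : vectType R) (ip : {dot V for idfun})
    (w : V) : {vspace V} :=
  orthov ip <[w]>%VS.

Section Subspace.
Variables (V : vectType R) (ip : {dot V for idfun}) (U : {vspace V}).

Definition sub_dot (u v : subvs_of U) : R := ip (vsval u) (vsval v).

Fact sub_dot_bilinear : bilinear_for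
  (GRing.Scale.Law.clone _ _ *%R _) (GRing.Scale.Law.clone _ _ (idfun \; *%R) _)
  sub_dot.
Proof.
split=> [w|w] a u v; rewrite /sub_dot linearP.
- by rewrite linearPl.
- by [].
Qed.
HB.instance Definition _ := bilinear_isBilinear.Build R _ _ _ _ _ sub_dot
  sub_dot_bilinear.

Fact sub_dot_sym u v : sub_dot u v = (-1) ^+ false * idfun (sub_dot v u).
Proof. exact: hermC. Qed.
HB.instance Definition _ := isHermitianSesquilinear.Build R _ false idfun
  sub_dot sub_dot_sym.

Fact sub_dot_gt0 u : u != 0 -> 0 < sub_dot u u.
Proof. by move=> u0; apply: neq0_dnorm_gt0. Qed.
HB.instance Definition _ := isDotProduct.Build R _ sub_dot sub_dot_gt0.
End Subspace.

Section DirectSum.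
Variables (U V : vectType R) (ipU : {dot U for idfun}) (ipV : {dot V for idfun}).

Definition dsum_dot (u v : (U * V)%type) : R := ipU u.1 v.1 + ipV u.2 v.2.

Fact dsum_dot_bilinear : bilinear_for
  (GRing.Scale.Law.clone _ _ *%R _) (GRing.Scale.Law.clone _ _ (idfun \; *%R) _)
  dsum_dot.
Proof.
split=> [w|w] a u v; rewrite /dsum_dot /=.
- by rewrite !linearPl mulrDr addrACA.
- by rewrite !linearPr /= mulrDr addrACA.
Qed.
HB.instance Definition _ := bilinear_isBilinear.Build R _ _ _ _ _ dsum_dot
  dsum_dot_bilinear.

Fact dsum_dot_sym u v : dsum_dot u v = (-1) ^+ false * idfun (dsum_dot v u).
Proof. by rewrite /dsum_dot hermC [ipV _ _]hermC /= !expr0 !mul1r. Qed.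
HB.instance Definition _ := isHermitianSesquilinear.Build R _ false idfun
  dsum_dot dsum_dot_sym.

Fact dsum_dot_gt0 u : u != 0 -> 0 < dsum_dot u u.
Proof.
have ge0 (X : vectType R) (ip : {dot X for idfun}) x : 0 <= ip x x.
  have [->|/(@neq0_dnorm_gt0 _ _ _ ip)/ltW//] := eqVneq x 0.
  by rewrite linear0r.
case: u => x y; rewrite xpair_eqE negb_and /dsum_dot /=.
by case/orP=> n0; [apply: ltr_wpDr|apply: ltr_wpDl] => //;
  apply: neq0_dnorm_gt0.
Qed.
HB.instance Definition _ := isDotProduct.Build R _ dsum_dot dsum_dot_gt0.
End DirectSum.

Definition real_dot (a b : R^o) : R := a * b.

Fact real_dot_bilinear : bilinear_for
  (GRing.Scale.Law.clone _ _ *%R _) (GRing.Scale.Law.clone _ _ (idfun \; *%R) _)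
  real_dot.
Proof.
split=> [w|w] a u v; rewrite /real_dot /=.
- by rewrite mulrDl -mulrA.
- by rewrite mulrDr mulrCA.
Qed.
HB.instance Definition _ := bilinear_isBilinear.Build R _ _ _ _ _ real_dot
  real_dot_bilinear.

Fact real_dot_sym u v : real_dot u v = (-1) ^+ false * idfun (real_dot v u).
Proof. by rewrite /= expr0 mul1r; exact: mulrC. Qed.
HB.instance Definition _ := isHermitianSesquilinear.Build R _ false idfun
  real_dot real_dot_sym.

Fact real_dot_gt0 u : u != 0 -> 0 < real_dot u u.
Proof. by move=> u0; rewrite /real_dot -expr2 lt_def sqrf_eq0 u0 sqr_ge0. Qed.
HB.instance Definition _ := isDotProduct.Build R _ real_dot real_dot_gt0.

End HilbertSpaces.

Section Structures.
Variable R : realType.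

Record normed_algebra (W : vectType R) (ip : {dot W for idfun})
    (mul : W -> W -> W) (one : W) : Prop := NormedAlgebra {
  na_bilinear : bilinear_for *:%R *:%R mul;
  na_one_unit : hilbert_norm ip one = 1;
  na_mul1u : forall u, mul one u = u;
  na_mulu1 : forall u, mul u one = u;
  na_norm : forall u v,
    hilbert_norm ip (mul u v) = hilbert_norm ip u * hilbert_norm ip v }.

Record cross_product (V : vectType R) (ip : {dot V for idfun})
    (cross : V -> V -> V) : Prop := CrossProduct {
  cp_bilinear : bilinear_for *:%R *:%R cross;
  cp_skew : forall u v, cross u v = - cross v u;
  cp_orthl : forall u v, ip (cross u v) u = 0;
  cp_orthr : forall u v, ip (cross u v) v = 0;
  cp_norm : forall u v, hilbert_norm ip (cross u v) ^+ 2
    = hilbert_norm ip u ^+ 2 * hilbert_norm ip v ^+ 2 - ip u v ^+ 2 }.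

Record normed_algebra_iso
    (W1 : vectType R) (ip1 : {dot W1 for idfun}) (mul1 : W1 -> W1 -> W1) (one1 : W1)
    (W2 : vectType R) (ip2 : {dot W2 for idfun}) (mul2 : W2 -> W2 -> W2) (one2 : W2)
    (f : W1 -> W2) : Prop := NormedAlgebraIso {
  nai_linear : linear f;
  nai_bij : bijective f;
  nai_isometry : isometry ip2 ip1 f;
  nai_mul : {morph f : u v / mul1 u v >-> mul2 u v};
  nai_one : f one1 = one2 }.

Record cross_product_iso
    (V1 : vectType R) (ip1 : {dot V1 for idfun}) (cross1 : V1 -> V1 -> V1)
    (V2 : vectType R) (ip2 : {dot V2 for idfun}) (cross2 : V2 -> V2 -> V2)
    (f : V1 -> V2) : Prop := CrossProductIso {
  cpi_linear : linear f;
  cpi_bij : bijective f;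
  cpi_isometry : isometry ip2 ip1 f;
  cpi_cross : {morph f : u v / cross1 u v >-> cross2 u v} }.

End Structures.

Section Constructions.
Variable R : realType.

(* [vsproj] returns a vector of W unchanged when it lies in the subspace, and
   some projection of it otherwise; that [mul u v + ip u v *: one] lies in the
   orthogonal complement of [one] is thus not part of this definition. *)
Definition cross_of_mul (W : vectType R) (ip : {dot W for idfun})
    (mul : W -> W -> W) (one : W)
    (u v : subvs_of (orthogonal_complement ip one)) :
    subvs_of (orthogonal_complement ip one) :=
  vsproj _ (mul (vsval u) (vsval v) + ip (vsval u) (vsval v) *: one).

Definition mul_of_cross (V : vectType R) (ip : {dot V for idfun})
    (cross : V -> V -> V) (u v : (R^o * V)%type) : (R^o * V)%type :=
  (u.1 * v.1 - ip u.2 v.2, u.1 *: v.2 + v.1 *: u.2 + cross u.2 v.2).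

Definition one_of_cross (V : vectType R) : (R^o * V)%type := (1, 0).

End Constructions.

Section ClassicalAlgebras.
Variable R : realType.

Definition real_mul (a b : R^o) : R^o := a * b.
Definition real_one : R^o := 1.

(* The library's [Rcomplex R] is [R[i]] as an algebra over [R]; it lacks the
   finite dimensional structure. *)
Fact complex_vect_axiom : Vector.axiom 2 (Rcomplex R).
Proof.
exists (fun z : Rcomplex R => \row_(i < 2) (if i == 0 then complex.Re z else complex.Im z)).
- by move=> a [x1 y1] [x2 y2]; apply/rowP=> i; rewrite !mxE; case: ifP.
- exists (fun v : 'rV_2 => Complex (v 0 0) (v 0 1)).
  + by case=> x y; rewrite !mxE.
  + move=> v; apply/rowP=> i; rewrite !mxE.
    by case: i => [[|[|//]]] Hi /=; congr (v _ _); apply/val_inj.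
Qed.
HB.instance Definition _ :=
  Lmodule_hasFinDim.Build R (Rcomplex R) complex_vect_axiom.

Definition complex_dot (z w : Rcomplex R) : R :=
  complex.Re z * complex.Re w + complex.Im z * complex.Im w.

Fact complex_dot_bilinear : bilinear_for
  (GRing.Scale.Law.clone _ _ *%R _) (GRing.Scale.Law.clone _ _ (idfun \; *%R) _)
  complex_dot.
Proof.
split=> [[w1 w2]|[w1 w2]] a [u1 u2] [v1 v2]; rewrite /complex_dot /=.
- by rewrite !mulrDl mulrDr !mulrA addrACA.
- by rewrite !mulrDr !(mulrCA _ a) addrACA.
Qed.
HB.instance Definition _ := bilinear_isBilinear.Build R _ _ _ _ _ complex_dot
  complex_dot_bilinear.

Fact complex_dot_sym u v : complex_dot u v = (-1) ^+ false * idfun (complex_dot v u).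
Proof. by rewrite /= expr0 mul1r /complex_dot mulrC [X in _ + X]mulrC. Qed.
HB.instance Definition _ := isHermitianSesquilinear.Build R _ false idfun
  complex_dot complex_dot_sym.

Fact complex_dot_gt0 u : u != 0 -> 0 < complex_dot u u.
Proof.
case: u => x y; rewrite eq_complex /= negb_and /complex_dot /= -!expr2.
by case/orP=> n0; [apply: ltr_wpDr|apply: ltr_wpDl];
  rewrite ?sqr_ge0 // lt_def sqrf_eq0 n0 sqr_ge0.
Qed.
HB.instance Definition _ := isDotProduct.Build R _ complex_dot complex_dot_gt0.

Definition complex_mul (z w : Rcomplex R) : Rcomplex R := z * w.
Definition complex_one : Rcomplex R := 1.

(* [(a, b, c, d)] is the quaternion a + bi + cj + dk. *)
Definition quaternion : vectType R := (R^o * R^o * R^o * R^o)%type.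

Definition quaternion_dot : {dot quaternion for idfun} :=
  dsum_dot (dsum_dot (dsum_dot (@real_dot R) (@real_dot R)) (@real_dot R))
    (@real_dot R).

Definition quaternion_mul (p q : quaternion) : quaternion :=
  let: (a, b, c, d) := p in let: (a', b', c', d') := q in
  (a * a' - b * b' - c * c' - d * d',
   a * b' + b * a' + c * d' - d * c',
   a * c' - b * d' + c * a' + d * b',
   a * d' + b * c' - c * b' + d * a').
Definition quaternion_one : quaternion := (1, 0, 0, 0).
Definition quaternion_conj (p : quaternion) : quaternion :=
  let: (a, b, c, d) := p in (a, - b, - c, - d).

(* Cayley--Dickson doubling of the quaternions. *)
Definition octonion : vectType R := (quaternion * quaternion)%type.

Definition octonion_dot : {dot octonion for idfun} :=
  dsum_dot quaternion_dot quaternion_dot.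

Definition octonion_mul (x y : octonion) : octonion :=
  let: (a, b) := x in let: (c, d) := y in
  (quaternion_mul a c - quaternion_mul (quaternion_conj d) b,
   quaternion_mul d a + quaternion_mul b (quaternion_conj c)).
Definition octonion_one : octonion := (quaternion_one, 0).

End ClassicalAlgebras.

(* Main.v *)
Require Import Defs.
From HB Require Import structures.
From mathcomp Require Import all_boot all_order all_algebra all_reals.
From mathcomp Require Import sesquilinear complex.
From mathcomp Require Import ring lra.

Set Implicit Arguments.
Unset Strict Implicit.
Unset Printing Implicit Defensive.

Import Order.TTheory GRing.Theory Num.Theory.
Local Open Scope ring_scope.

(** A normed algebra is governed by one identity.  Polarizing
    [|uv|^2 = |u|^2 |v|^2] in both factors gives
      [<ux, vy> + <vx, uy> = 2 <u, v> <x, y>],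
    and with the conjugation [u^* = 2 <u, 1> - u] this says that the adjoint of
    left (right) multiplication by [u] is left (right) multiplication by [u^*].
    As the inner product is nondegenerate, every identity between products can
    be tested against an arbitrary vector; in this way one gets
      [u^* (v x) + v^* (u x) = 2 <u, v> x],  [(x u) v^* + (x v) u^* = 2 <u, v> x]
      and  [(u v)^* = v^* u^*].

    The two constructions.  For imaginary [u] and [v] (orthogonal to [1]) the
    real part of [uv] is [- <u, v>], so [u x v] is the imaginary part of [uv];
    [uv + vu = - 2 <u, v>] makes it skew, and the norm identity becomes
    [|u x v|^2 + <u, v>^2 = |u|^2 |v|^2].  Read backwards, this computation
    shows that a cross product yields a normed algebra, and that splitting an
    algebra into its real and imaginary parts inverts the construction.

    Classification.  Let [f : K -> W] be an embedding of a unital algebra with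
    inner product that is not onto, and let [i] be a unit vector orthogonal to
    its image.  The identities above determine all products of elements
    [f a + (f b) i], and they are those of the Cayley-Dickson double of [K];
    hence the double embeds as well ([cayley_dickson_embedding]).  Starting with
    the real line, [W] is therefore the reals, the complex numbers, the
    quaternions or the octonions, each of which is the double of the previous
    one, or else the double of the octonions embeds in [W].  The last case is
    impossible: that double has zero divisors
    ([octonion_double_zero_divisor]) and [W] has none. *)

(** * Linear maps and inner products *)

(** On [R^o] scaling and multiplication are convertible but distinct, and
    [ring] only knows the latter. *)
Lemma scale_regularE (R : realType) (a : R) (x : R^o) : a *: x = a * x.
Proof. by []. Qed.

Section LinearMaps.
Variables (R : realType) (U V : vectType R) (f : U -> V).
Hypothesis lin_f : linear f.

Lemma linear_map0 : f 0 = 0.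
Proof. by have := lin_f (-1) 0 0; rewrite !scaleN1r oppr0 addr0 addNr. Qed.

Lemma linear_mapD u v : f (u + v) = f u + f v.
Proof. by have := lin_f 1 u v; rewrite !scale1r. Qed.

Lemma linear_mapZ a u : f (a *: u) = a *: f u.
Proof. by have := lin_f a u 0; rewrite linear_map0 !addr0. Qed.

Lemma linear_mapN u : f (- u) = - f u.
Proof. by rewrite -scaleN1r linear_mapZ scaleN1r. Qed.

Lemma linear_mapB u v : f (u - v) = f u - f v.
Proof. by rewrite linear_mapD linear_mapN. Qed.

(** Turns a function known to be linear into one to which kernels, images and
    the dimension formula apply. *)
Lemma linear_map_hom : exists F : 'Hom(U, V), F =1 f.
Proof.
pose g : {linear U -> V} :=
  HB.pack_for {linear U -> V} f (GRing.isLinear.Build R U V *:%R f lin_f).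
by exists (linfun g) => u; rewrite lfunE.
Qed.

End LinearMaps.

Section DotProduct.
Variables (R : realType) (V : vectType R) (ip : {dot V for idfun}).
Local Notation "''[' u , v ]" := (ip u v).

Lemma dotC u v : '[u, v] = '[v, u].
Proof. by rewrite hermC /= mul1r. Qed.

Lemma dotDl u v w : '[u + v, w] = '[u, w] + '[v, w].
Proof. exact: linearDl. Qed.

Lemma dotZl a u w : '[a *: u, w] = a * '[u, w].
Proof. exact: linearZl_LR. Qed.

Lemma dotNl u w : '[- u, w] = - '[u, w].
Proof. exact: linearNl. Qed.

Lemma dotDr u v w : '[w, u + v] = '[w, u] + '[w, v].
Proof. exact: linearDr. Qed.

Lemma dotZr a u w : '[w, a *: u] = a * '[w, u].
Proof. by rewrite dotC dotZl dotC. Qed.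

Lemma dotNr u w : '[w, - u] = - '[w, u].
Proof. exact: linearNr. Qed.

Lemma dot0l w : '[0, w] = 0.
Proof. exact: linear0l. Qed.

Lemma dot0r w : '[w, 0] = 0.
Proof. exact: linear0r. Qed.

Definition dotE := (dotDl, dotDr, dotNl, dotNr, dotZl, dotZr).

Lemma dot_ge0 u : 0 <= '[u, u].
Proof.
by have [->|/(@neq0_dnorm_gt0 _ _ _ ip)/ltW//] := eqVneq u 0; rewrite dot0l.
Qed.

Lemma dot_eq0 u : '[u, u] = 0 -> u = 0.
Proof.
by move=> u0; apply/eqP/negP => /negP/(@neq0_dnorm_gt0 _ _ _ ip); rewrite u0 ltxx.
Qed.

(** Nondegeneracy.  All identities between vectors below are proved by testing
    them against an arbitrary [w], where they become polynomial identities in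
    inner products. *)
Lemma dot_inj u v : (forall w, '[u, w] = '[v, w]) -> u = v.
Proof.
move=> uv; apply/eqP; rewrite -subr_eq0; apply/eqP/dot_eq0.
by rewrite dotDl dotNl uv subrr.
Qed.

Lemma sqr_hilbert_norm u : hilbert_norm ip u ^+ 2 = '[u, u].
Proof. by rewrite sqr_sqrtr ?dot_ge0. Qed.

Lemma mem_orthogonal_complement w u :
  (u \in orthogonal_complement ip w) = ('[u, w] == 0).
Proof. exact: mem_orthov1. Qed.

Lemma dsum_real_dotE (x y : (R^o * V)%type) :
  (dsum_dot (@real_dot R) ip : {dot (R^o * V)%type for idfun}) x y
  = (x.1 : R) * y.1 + '[x.2, y.2].
Proof. by []. Qed.

End DotProduct.

(** * Identities in a normed algebra *)

Section Conjugation.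
Variables (R : realType) (W : vectType R) (ip : {dot W for idfun}) (one : W).

(** The reflection that fixes [one] and negates its orthogonal complement; only
    the inner product and the unit enter, so it also makes sense on an algebra
    not known to be normed. *)
Definition na_conj (u : W) : W := (2 * ip u one) *: one - u.

End Conjugation.

Section NormedAlgebraTheory.
Variables (R : realType) (W : vectType R) (ip : {dot W for idfun}).
Variables (mul : W -> W -> W) (one : W).
Hypothesis na : normed_algebra ip mul one.
Local Notation "''[' u , v ]" := (ip u v).
Local Notation "u ** v" := (mul u v) (at level 40, left associativity).
Local Notation conj := (na_conj ip one).

Let lin_l v : linear (mul^~ v) := (na_bilinear na).1 v.
Let lin_r u : linear (mul u) := (na_bilinear na).2 u.

Lemma na_mulDl u v w : (u + v) ** w = u ** w + v ** w.
Proof. exact: linear_mapD (lin_l w) u v. Qed.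
Lemma na_mulDr u v w : w ** (u + v) = w ** u + w ** v.
Proof. exact: linear_mapD (lin_r w) u v. Qed.
Lemma na_mulNl u w : (- u) ** w = - (u ** w).
Proof. exact: linear_mapN (lin_l w) u. Qed.
Lemma na_mulNr u w : w ** (- u) = - (w ** u).
Proof. exact: linear_mapN (lin_r w) u. Qed.
Lemma na_mulZl a u w : (a *: u) ** w = a *: (u ** w).
Proof. exact: linear_mapZ (lin_l w) a u. Qed.
Lemma na_mulZr a u w : w ** (a *: u) = a *: (w ** u).
Proof. exact: linear_mapZ (lin_r w) a u. Qed.

Definition na_mulE := (na_mulDl, na_mulDr, na_mulNl, na_mulNr, na_mulZl, na_mulZr).

Lemma na_dot11 : '[one, one] = 1.
Proof. by rewrite -sqr_hilbert_norm (na_one_unit na) expr1n. Qed.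

Lemma na_dotMM u v : '[u ** v, u ** v] = '[u, u] * '[v, v].
Proof. by rewrite -!sqr_hilbert_norm (na_norm na) exprMn. Qed.

(** The norm identity for [u] and [x + y], compared with those for [x] and
    [y], leaves the mixed terms. *)
Lemma na_dot_mulr u x y : '[u ** x, u ** y] = '[u, u] * '[x, y].
Proof.
have := na_dotMM u (x + y); rewrite na_mulDr !dotE !na_dotMM.
by rewrite (dotC ip y x) (dotC ip (u ** y)); lra.
Qed.

Lemma na_dot_mull u x y : '[x ** u, y ** u] = '[x, y] * '[u, u].
Proof.
have := na_dotMM (x + y) u; rewrite na_mulDl !dotE !na_dotMM.
by rewrite (dotC ip y x) (dotC ip (y ** u)); lra.
Qed.

(** The norm identity polarized in both factors; every later identity is an
    instance of it. *)
Lemma na_dot_exchange u v x y :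
  '[u ** x, v ** y] + '[v ** x, u ** y] = 2 * '[u, v] * '[x, y].
Proof.
have := na_dot_mulr (u + v) x y; rewrite !na_mulDl !dotE !na_dot_mulr.
by rewrite (dotC ip v u); lra.
Qed.

(** The exchange law with [v] the unit. *)
Lemma na_dot_conjl u x y : '[u ** x, y] = '[x, conj u ** y].
Proof.
have := na_dot_exchange u one x y; rewrite !(na_mul1u na) => H.
by rewrite /na_conj !na_mulE !dotE (na_mul1u na); lra.
Qed.

Lemma na_dot_conjr u x y : '[x ** u, y] = '[x, y ** conj u].
Proof.
have := na_dot_exchange x y u one; rewrite !(na_mulu1 na) (dotC ip (y ** u)) => H.
by rewrite /na_conj !na_mulE !dotE (na_mulu1 na); lra.
Qed.

Lemma na_conjK u : conj (conj u) = u.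
Proof.
by apply: (@dot_inj _ _ ip) => w; rewrite /na_conj !dotE na_dot11; lra.
Qed.

Lemma na_dot_conj u v : '[conj u, v] = '[u, conj v].
Proof. by rewrite /na_conj !dotE (dotC ip one); lra. Qed.

(** The exchange law with the multiplications moved to one side of the inner
    product.  When [u] and [v] are orthogonal this is a substitute for
    associativity: [u^* (v x) = - v^* (u x)]. *)
Lemma na_conj_mul_exchange u v x :
  conj u ** (v ** x) + conj v ** (u ** x) = (2 * '[u, v]) *: x.
Proof.
apply: (@dot_inj _ _ ip) => t.
rewrite !dotE (na_dot_conjl (conj u)) (na_dot_conjl (conj v)) !na_conjK.
by rewrite addrC na_dot_exchange.
Qed.

Lemma na_conj_mulK u x : conj u ** (u ** x) = '[u, u] *: x.
Proof.
apply: (@dot_inj _ _ ip) => t.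
by rewrite na_dot_conjl na_conjK na_dot_mulr dotZl.
Qed.

Lemma na_mul_conj_exchange u v x :
  (x ** u) ** conj v + (x ** v) ** conj u = (2 * '[u, v]) *: x.
Proof.
apply: (@dot_inj _ _ ip) => t.
rewrite !dotE (na_dot_conjr (conj u)) (na_dot_conjr (conj v)) !na_conjK.
by have := na_dot_exchange x t u v; rewrite (dotC ip (t ** u)); lra.
Qed.

(** Both sides have inner product [<u v, t^*> = <u^*, v t>] with [t], by moving
    one factor at a time across the inner product. *)
Lemma na_conjM u v : conj (u ** v) = conj v ** conj u.
Proof.
apply: (@dot_inj _ _ ip) => t.
by rewrite na_dot_conj na_dot_conjl dotC na_dot_conjr na_conjK [RHS]na_dot_conjl na_conjK.
Qed.

(** * From normed algebras to cross products *)

Lemma na_dot1 (u : subvs_of (orthogonal_complement ip one)) : '[vsval u, one] = 0.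
Proof. by apply/eqP; rewrite -mem_orthogonal_complement subvsP. Qed.

Lemma na_conj_orthogonal u : '[u, one] = 0 -> conj u = - u.
Proof. by move=> u1; rewrite /na_conj u1 mulr0 scale0r add0r. Qed.

Lemma na_dot_mul1 u v : '[v, one] = 0 -> '[u ** v, one] = - '[u, v].
Proof.
by move=> v1; rewrite na_dot_conjr na_conj_orthogonal // (na_mul1u na) dotNr.
Qed.

Lemma na_mul_anticomm u v : '[u, one] = 0 -> '[v, one] = 0 ->
  u ** v + v ** u = - (2 * '[u, v]) *: one.
Proof.
move=> u1 v1; have := na_conj_mul_exchange u v one.
rewrite !na_conj_orthogonal // !na_mulNl !(na_mulu1 na) -opprD => H.
by rewrite scaleNr -H opprK.
Qed.

Local Notation imag := (orthogonal_complement ip one).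

(** The right-hand side has no real part, so the projection onto the orthogonal
    complement of [one] leaves it alone. *)
Lemma cross_of_mulE (u v : subvs_of imag) :
  vsval (cross_of_mul mul u v)
  = vsval u ** vsval v + '[vsval u, vsval v] *: one.
Proof.
rewrite vsprojK // mem_orthogonal_complement !dotE na_dot11.
by rewrite na_dot_mul1 ?na_dot1 // mulr1 addNr.
Qed.

Lemma cross_of_mul_cross_product :
  cross_product (sub_dot ip (U := imag)) (@cross_of_mul R W ip mul one).
Proof.
split.
- by split=> w a u v; apply: subvs_inj; rewrite cross_of_mulE !linearP /=
    !cross_of_mulE; apply: (@dot_inj _ _ ip) => t; rewrite !na_mulE !dotE; ring.
- move=> u v; apply: subvs_inj; rewrite linearN /= !cross_of_mulE.
  have := na_mul_anticomm (na_dot1 u) (na_dot1 v) => /(canRL (addrK _)) ->.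
  by apply: (@dot_inj _ _ ip) => t; rewrite !dotE (dotC ip (vsval v) (vsval u)); ring.
- move=> u v; rewrite /= /sub_dot cross_of_mulE !dotE.
  (* [<u v, u> = <u v, u 1> = <u, u> <v, 1>] *)
  rewrite -[X in '[_, X]](na_mulu1 na) na_dot_mulr na_dot1.
  by rewrite (dotC ip one) na_dot1 !mulr0 addr0.
- move=> u v; rewrite /= /sub_dot cross_of_mulE !dotE.
  rewrite -[X in '[_ ** _, X]](na_mul1u na) na_dot_mull.
  by rewrite na_dot1 (dotC ip one) na_dot1 mul0r mulr0 addr0.
- move=> u v; rewrite !sqr_hilbert_norm /= /sub_dot cross_of_mulE !dotE na_dotMM na_dot11.
  by rewrite (dotC ip one) na_dot_mul1 ?na_dot1 //; ring.
Qed.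

(** Splitting off the real part, [w = <w, one> one + (w - <w, one> one)], gives
    the inverse map. *)
Lemma algebra_of_cross_of_mul_iso :
  let V : vectType R := subvs_of imag in
  let ipV : {dot V for idfun} := sub_dot ip (U := imag) in
  normed_algebra_iso (dsum_dot (@real_dot R) ipV)
    (mul_of_cross ipV (@cross_of_mul R W ip mul one)) (one_of_cross V)
    ip mul one (fun x : (R^o * V)%type => x.1 *: one + vsval x.2).
Proof.
move=> V ipV; split.
- move=> a [x0 x1] [y0 y1] /=; rewrite !linearP /=.
  by apply: (@dot_inj _ _ ip) => t; rewrite !dotE !scale_regularE; ring.
- exists (fun w => ('[w, one], vsproj imag (w - '[w, one] *: one))).
  + move=> [x0 x1] /=; rewrite !dotE na_dot1 na_dot11 mulr1 addr0 addrC addKr.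
    by rewrite vsvalK.
  + move=> w /=; rewrite vsprojK ?subrKC //.
    by rewrite mem_orthogonal_complement !dotE na_dot11 mulr1 subrr.
- move=> [x0 x1] [y0 y1]; apply: etrans (esym (dsum_real_dotE _ _ _)).
  rewrite /= /sub_dot !dotE.
  by rewrite na_dot11 na_dot1 (dotC ip one) na_dot1; ring.
- move=> [x0 x1] [y0 y1]; rewrite /mul_of_cross /=.
  rewrite cross_of_mulE; apply: (@dot_inj _ _ ip) => t.
  by rewrite !na_mulE !(na_mul1u na) !(na_mulu1 na) !dotE /sub_dot; ring.
- by rewrite /one_of_cross /= scale1r addr0.
Qed.

End NormedAlgebraTheory.

(** * From cross products to normed algebras *)

Section CrossProductTheory.
Variables (R : realType) (V : vectType R) (ip : {dot V for idfun}).
Variable cross : V -> V -> V.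
Hypothesis cp : cross_product ip cross.
Local Notation "''[' u , v ]" := (ip u v).
Local Notation "u ** v" := (cross u v) (at level 40, left associativity).

Let lin_l v : linear (cross^~ v) := (cp_bilinear cp).1 v.
Let lin_r u : linear (cross u) := (cp_bilinear cp).2 u.

(** In [|uv|^2] the terms mixing [u1 x v1] with [u1] and [v1] vanish, and
    [|u1 x v1|^2 = |u1|^2 |v1|^2 - <u1, v1>^2] cancels the square of
    [<u1, v1>] coming from the real part. *)
Lemma mul_of_cross_normed_algebra :
  normed_algebra (dsum_dot (@real_dot R) ip) (mul_of_cross ip cross)
    (one_of_cross V).
Proof.
split.
- split=> [[w0 w1]|[w0 w1]] a [u0 u1] [v0 v1]; rewrite /mul_of_cross /=.
  + congr (_, _) => /=; first by rewrite !dotE !scale_regularE; ring.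
    rewrite (linear_mapD (lin_l _)) (linear_mapZ (lin_l _)).
    by apply: (@dot_inj _ _ ip) => t; rewrite !dotE !scale_regularE; ring.
  + congr (_, _) => /=; first by rewrite !dotE !scale_regularE; ring.
    rewrite (linear_mapD (lin_r _)) (linear_mapZ (lin_r _)).
    by apply: (@dot_inj _ _ ip) => t; rewrite !dotE !scale_regularE; ring.
- by rewrite /hilbert_norm dsum_real_dotE /= dot0l addr0 mulr1 sqrtr1.
- move=> [u0 u1]; rewrite /mul_of_cross /= dot0l subr0 mul1r scale1r scaler0 addr0.
  by rewrite (linear_map0 (lin_l _)) addr0.
- move=> [u0 u1]; rewrite /mul_of_cross /= dot0r subr0 mulr1 scale1r scaler0 add0r.
  by rewrite (linear_map0 (lin_r _)) addr0.
- move=> [u0 u1] [v0 v1]; rewrite /hilbert_norm -sqrtrM ?dot_ge0 //.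
  congr Num.sqrt; rewrite !dsum_real_dotE /mul_of_cross /= !dotE.
  have := cp_norm cp u1 v1; rewrite !sqr_hilbert_norm => ->.
  rewrite (dotC ip _ (u1 ** v1)) (dotC ip _ (u1 ** v1)) (cp_orthl cp) (cp_orthr cp).
  by rewrite (dotC ip v1 u1); ring.
Qed.

Let W : vectType R := (R^o * V)%type.
Let ipW : {dot W for idfun} := dsum_dot (@real_dot R) ip.
Let one : W := one_of_cross V.
Let iota : V -> subvs_of (orthogonal_complement ipW one) :=
  fun v => vsproj _ ((0, v) : W).

Lemma vsval_iota v : vsval (iota v) = (0, v).
Proof.
rewrite vsprojK // mem_orthogonal_complement dsum_real_dotE /=.
by rewrite mul0r dot0r addr0.
Qed.

Lemma cross_of_mul_of_cross_iso :
  cross_product_iso ip cross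
    (sub_dot ipW (U := orthogonal_complement ipW one))
    (@cross_of_mul R W ipW (mul_of_cross ip cross) one) iota.
Proof.
split.
- move=> a u v; apply: subvs_inj; rewrite linearP /= !vsval_iota.
  by congr (_, _); rewrite /= scaler0 addr0.
- exists (fun w : subvs_of (orthogonal_complement ipW one) => (vsval w).2) => [v|w].
    by rewrite vsval_iota.
  apply: subvs_inj; rewrite vsval_iota.
  have /eqP := subvsP w; rewrite mem_orthogonal_complement dsum_real_dotE /=.
  case: (vsval w) => w0 w1 /eqP /=.
  by rewrite dot0r addr0 mulr1 => /eqP ->.
- move=> u v; rewrite /= /sub_dot !vsval_iota dsum_real_dotE /=.
  by rewrite mul0r add0r.
- move=> u v; apply: subvs_inj.
  rewrite (cross_of_mulE mul_of_cross_normed_algebra) !vsval_iota.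
  rewrite /mul_of_cross dsum_real_dotE /= !scale0r !add0r.
  congr (_, _) => /=; last by rewrite scaler0 addr0.
  by rewrite scale_regularE; ring.
Qed.

End CrossProductTheory.

(** * Cayley-Dickson doubling inside a normed algebra *)

Section Embeddings.
Variable R : realType.

(** The source need not be a normed algebra: in the end it is the double of the
    octonions, for which an embedding is to be refuted. *)
Record unital_embedding
    (K : vectType R) (ipK : {dot K for idfun}) (mulK : K -> K -> K) (oneK : K)
    (W : vectType R) (ip : {dot W for idfun}) (mul : W -> W -> W) (one : W)
    (f : K -> W) : Prop := UnitalEmbedding {
  ue_linear : linear f;
  ue_isometry : isometry ip ipK f;
  ue_mul : {morph f : u v / mulK u v >-> mul u v};
  ue_one : f oneK = one }.

Variables (K : vectType R) (ipK : {dot K for idfun}).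
Variables (mulK : K -> K -> K) (oneK : K).

(** [(a, b)] stands for [a + b i], where [i] is a new unit anticommuting with
    the imaginary elements of [K]. *)
Definition cayley_dickson_mul (conj : K -> K) (x y : (K * K)%type) : (K * K)%type :=
  (mulK x.1 y.1 - mulK (conj y.2) x.2, mulK y.2 x.1 + mulK x.2 (conj y.1)).

Variables (W : vectType R) (ip : {dot W for idfun}).
Variables (mul : W -> W -> W) (one : W).
Hypothesis na : normed_algebra ip mul one.
Local Notation "''[' u , v ]" := (ip u v).
Local Notation "u ** v" := (mul u v) (at level 40, left associativity).
Local Notation conj := (na_conj ip one).
Local Notation embedding f := (unital_embedding ipK mulK oneK ip mul one f).

Lemma unital_embedding_comp (K' : vectType R) (ipK' : {dot K' for idfun})
    (mulK' : K' -> K' -> K') (oneK' : K') (h : K' -> K) (f : K -> W) :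
  unital_embedding ipK' mulK' oneK' ipK mulK oneK h -> embedding f ->
  unital_embedding ipK' mulK' oneK' ip mul one (f \o h).
Proof.
move=> [hl hi hm h1] [fl fi fm f1]; split => /=.
- by move=> a u v /=; rewrite hl fl.
- by move=> u v /=; rewrite fi hi.
- by move=> u v /=; rewrite hm fm.
- by rewrite h1 f1.
Qed.

Lemma unital_embedding_inj f : embedding f -> injective f.
Proof.
move=> [fl fi _ _] u v fuv; apply: (@dot_inj _ _ ipK) => w.
by rewrite -!fi fuv.
Qed.

Lemma unital_embedding_conj f : embedding f ->
  {morph f : u / na_conj ipK oneK u >-> conj u}.
Proof.
move=> [fl fi _ f1] u; rewrite /na_conj (linear_mapB fl) (linear_mapZ fl).
by rewrite f1 -fi f1.
Qed.

(** The next lemmas compute the products of elements [f a] and [(f b) i], for a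
    unit vector [i] orthogonal to the image of [f].  Orthogonality makes the
    right-hand sides of the exchange laws vanish. *)
Section Doubling.
Variable f : K -> W.
Hypothesis fe : embedding f.
Variable i : W.
Hypotheses (i_unit : '[i, i] = 1) (i_orth : forall x, '[f x, i] = 0).

Let fl := ue_linear fe.

Let i1 : '[i, one] = 0.
Proof. by rewrite dotC -(ue_one fe). Qed.

Let i_conj : conj i = - i.
Proof. exact: na_conj_orthogonal. Qed.

Let conj_orth a : '[conj (f a), i] = 0.
Proof. by rewrite -(unital_embedding_conj fe) i_orth. Qed.

(** [a i] is imaginary since [a] is orthogonal to [i], so
    [- (a i) = (a i)^* = i^* a^* = - (i a^* )]. *)
Lemma mul_orth_conj a : f a ** i = i ** conj (f a).
Proof.
have := na_conjM na (f a) i; rewrite na_conj_orthogonal; last first.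
  by rewrite na_dot_mul1 // i_orth oppr0.
by rewrite i_conj (na_mulNl na) => /oppr_inj.
Qed.

(** [a (d i) = a (i d^* )], and [a] is moved past [i] by the left exchange
    law: [a (i d^* ) = i (a^* d^* ) = i (d a)^* = (d a) i]. *)
Lemma mul_right_doubler a d : f a ** (f d ** i) = (f d ** f a) ** i.
Proof.
have := na_conj_mul_exchange na (conj (f a)) i (conj (f d)).
rewrite (na_conjK na) conj_orth mulr0 scale0r i_conj.
rewrite (na_mulNl na) -(na_conjM na) -mul_orth_conj => /subr0_eq ->.
by rewrite -(ue_mul fe) -mul_orth_conj.
Qed.

(** The right exchange law for the orthogonal elements [i] and [c^*], since
    [i^* = - i]. *)
Lemma mul_left_doubler b c : (f b ** i) ** f c = (f b ** conj (f c)) ** i.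
Proof.
have := na_mul_conj_exchange na i (conj (f c)) (f b).
rewrite (na_conjK na) (dotC ip i) conj_orth mulr0 scale0r i_conj.
by rewrite (na_mulNr na) => /subr0_eq.
Qed.

(** The left exchange law for [b i] and [i], applied to [d^*], gives
    [- (b i) (d i) + d^* b^* = 2 <b, 1> d^*]; here
    [2 <b, 1> d^* = d^* (b + b^* )]. *)
Lemma mul_doubler_doubler b d : (f b ** i) ** (f d ** i) = - (conj (f d) ** f b).
Proof.
have := na_conj_mul_exchange na (f b ** i) i (conj (f d)).
rewrite i_conj na_conj_orthogonal; last first.
  by rewrite (na_dot_mul1 na) // i_orth oppr0.
rewrite !(na_mulNl na) -mul_orth_conj.
have -> : f b ** i ** conj (f d) = i ** conj (f (mulK b d)).
  rewrite -(unital_embedding_conj fe) mul_left_doubler (unital_embedding_conj fe).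
  by rewrite (na_conjK na) -mul_orth_conj (ue_mul fe).
have -> x : i ** (i ** x) = - x.
  by rewrite -{1}(opprK i) -i_conj (na_mulNl na) (na_conj_mulK na) i_unit scale1r.
rewrite (ue_mul fe) (na_conjM na) => H.
have bi : '[f b ** i, i] = '[f b, one].
  by rewrite -[X in '[_, X]](na_mul1u na i) (na_dot_mull na) i_unit mulr1.
apply: (@dot_inj _ _ ip) => t; have := congr1 (ip^~ t) H.
rewrite /= bi [conj (f b)]/na_conj (na_mulDr na) (na_mulNr na) (na_mulZr na).
by rewrite (na_mulu1 na) !dotE; lra.
Qed.

Lemma cayley_dickson_embedding :
  unital_embedding (dsum_dot ipK ipK)
    (cayley_dickson_mul (na_conj ipK oneK)) (oneK, 0) ip mul one
    (fun x : (K * K)%type => f x.1 + f x.2 ** i).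
Proof.
split.
- move=> a [u0 u1] [v0 v1] /=; rewrite !fl !(na_mulE na).
  by apply: (@dot_inj _ _ ip) => t; rewrite !dotE; ring.
- move=> [u0 u1] [v0 v1] /=.
  have o a b : '[f a, f b ** i] = 0.
    by rewrite dotC (na_dot_conjl na) -(unital_embedding_conj fe) -(ue_mul fe) dotC i_orth.
  rewrite !dotE o (dotC ip (_ ** _)) o (na_dot_mull na) i_unit !(ue_isometry fe).
  by rewrite mulr1 addr0 add0r.
- move=> [u0 u1] [v0 v1] /=; rewrite /cayley_dickson_mul /= !(na_mulE na).
  rewrite mul_right_doubler mul_left_doubler mul_doubler_doubler.
  rewrite (linear_mapB fl) (linear_mapD fl) !(ue_mul fe) !(unital_embedding_conj fe).
  rewrite (na_mulDl na).
  by apply: (@dot_inj _ _ ip) => t; rewrite !dotE; ring.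
- by rewrite /= (linear_map0 fl) (ue_one fe) -[0](scale0r i) (na_mulZl na) !scale0r addr0.
Qed.

End Doubling.

(** The vectors orthogonal to the image of [f] solve [\dim K] linear equations,
    one for each basis vector of [K]; with fewer equations than unknowns there
    is a nonzero solution, which is then normalized. *)
Lemma exists_unit_orthogonal (f : K -> W) : linear f -> (\dim {:K} < \dim {:W})%N ->
  exists i, '[i, i] = 1 /\ forall x, '[f x, i] = 0.
Proof.
move=> fl ltKW; pose e := vbasis {:K}.
pose t w : 'rV[R]_(\dim {:K}) := \row_j '[f e`_j, w].
have tl : linear t by move=> a u v; apply/rowP => j; rewrite !mxE dotDr dotZr.
have [T tT] := linear_map_hom tl.
have kT : lker T != 0%VS.
  apply/negP => kT0; move: ltKW; rewrite ltnNge => /negP; apply.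
  rewrite -(limg_dim_eq (f := T)); last by rewrite (eqP kT0) capv0.
  apply: leq_trans (dimvS (subvf _)) _.
  by rewrite dimvf dim_matrix mul1r.
pose w := vpick (lker T).
have w0 : 0 < '[w, w] by apply: neq0_dnorm_gt0; rewrite vpick0.
have wo x : '[f x, w] = 0.
  rewrite [x](coord_vbasis (memvf x)).
  have [F fF] := linear_map_hom fl; rewrite -fF linear_sum dotC linear_sumr big1 //.
  move=> j _; rewrite linearZ /= fF dotZr dotC.
  have := memv_pick (lker T); rewrite memv_ker tT => /eqP/rowP/(_ j).
  by rewrite !mxE => ->; rewrite mulr0.
exists ((Num.sqrt '[w, w])^-1 *: w); split=> [|x]; last by rewrite dotZr wo mulr0.
rewrite dotZl dotZr mulrA -invfM -expr2 sqr_sqrtr ?(ltW w0) // mulVf //.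
by rewrite gt_eqF.
Qed.

(** An isometry is injective, so the dimension bound makes it bijective. *)
Lemma unital_embedding_iso f : embedding f -> (\dim {:W} <= \dim {:K})%N ->
  \dim {:W} = \dim {:K} /\
  exists g, normed_algebra_iso ip mul one ipK mulK oneK g.
Proof.
move=> fe leWK; have [F fF] := linear_map_hom (ue_linear fe).
have kF : lker F == 0%VS.
  by apply/lker0P => x y; rewrite !fF; apply: unital_embedding_inj.
have dF : \dim (limg F) = \dim {:K} by rewrite limg_dim_eq // (eqP kF) capv0.
have dWK : \dim {:W} = \dim {:K}.
  by apply/eqP; rewrite eqn_leq leWK -dF dimvS ?subvf.
have sF : limg F = fullv.
  by apply/eqP; rewrite eqEdim subvf dF dWK leqnn.
have FK : cancel F (F^-1)%VF by apply: lker0_lfunK.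
have KF : cancel (F^-1)%VF F by move=> w; apply: limg_lfunVK; rewrite sF memvf.
split=> //; exists (F^-1)%VF; split.
- exact: linearP.
- by exists F.
- by move=> u v; rewrite -[in RHS](KF u) -[in RHS](KF v) !fF (ue_isometry fe).
- by move=> u v; apply: (can_inj FK); rewrite KF [RHS]fF (ue_mul fe) -!fF !KF.
- by apply: (can_inj FK); rewrite KF fF (ue_one fe).
Qed.

Lemma unital_embedding_iso_or_double f : embedding f ->
  (\dim {:W} = \dim {:K} /\
   exists g, normed_algebra_iso ip mul one ipK mulK oneK g) \/
  exists g, unital_embedding (dsum_dot ipK ipK)
    (cayley_dickson_mul (na_conj ipK oneK)) (oneK, 0) ip mul one g.
Proof.
move=> fe; have [le|lt] := leqP (\dim {:W}) (\dim {:K}).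
  by left; apply: unital_embedding_iso fe le.
have [i [i1 io]] := exists_unit_orthogonal (ue_linear fe) lt.
by right; eexists; apply: cayley_dickson_embedding io.
Qed.

End Embeddings.

(** * The classical algebras as iterated doubles *)

Section Classification.
Variable R : realType.

Lemma real_conjE (a : R^o) : na_conj (@real_dot R) (real_one R) a = a.
Proof.
rewrite /na_conj /= /real_dot /real_one scale_regularE !mulr1.
by rewrite mulr_natl mulr2n addrK.
Qed.

Lemma real_double_embedding :
  unital_embedding (@complex_dot R) (@complex_mul R) (complex_one R)
    (dsum_dot (@real_dot R) (@real_dot R))
    (cayley_dickson_mul (@real_mul R) (na_conj (@real_dot R) (real_one R)))
    (real_one R, 0)
    (fun z : Rcomplex R => (complex.Re z, complex.Im z)).
Proof.
split.
- by move=> a [u0 u1] [v0 v1].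
- by move=> [u0 u1] [v0 v1].
- move=> [u0 u1] [v0 v1]; rewrite /cayley_dickson_mul /= !real_conjE /real_mul.
  by rewrite (mulrC v1) (mulrC v1).
- by [].
Qed.

Lemma complex_conjE (a b : R) :
  na_conj (@complex_dot R) (complex_one R) (Complex a b) = Complex a (- b).
Proof.
by rewrite /na_conj /= /complex_dot /=; apply/eqP; rewrite eq_complex /=;
  apply/andP; split; apply/eqP; ring.
Qed.

(** [a + b i + c j + d k = (a + b i) + (c + d i) j], because [i j = k]. *)
Lemma complex_double_embedding :
  unital_embedding (@quaternion_dot R) (@quaternion_mul R) (quaternion_one R)
    (dsum_dot (@complex_dot R) (@complex_dot R))
    (cayley_dickson_mul (@complex_mul R) (na_conj (@complex_dot R) (complex_one R)))
    (complex_one R, 0)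
    (fun q : quaternion R =>
       let: (a, b, c, d) := q in (Complex a b : Rcomplex R, Complex c d : Rcomplex R)).
Proof.
split.
- by move=> a [[[u0 u1] u2] u3] [[[v0 v1] v2] v3].
- by move=> [[[u0 u1] u2] u3] [[[v0 v1] v2] v3]; apply: addrA.
- move=> [[[u0 u1] u2] u3] [[[v0 v1] v2] v3].
  rewrite /cayley_dickson_mul /= !complex_conjE /complex_mul.
  by congr (_, _); apply/eqP; rewrite eq_complex /=; apply/andP; split;
    apply/eqP => /=; ring.
- by [].
Qed.

Lemma quaternion_conjE (q : quaternion R) :
  na_conj (@quaternion_dot R) (quaternion_one R) q = quaternion_conj q.
Proof.
case: q => [[[a b] c] d]; rewrite /na_conj.
have -> : quaternion_dot R (a, b, c, d) (quaternion_one R) = a.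
  rewrite -[LHS]/(a * 1 + b * 0 + c * 0 + d * 0).
  by rewrite !mulr0 !addr0 mulr1.
congr (_, _, _, _) => /=; rewrite scale_regularE ?mulr0 ?sub0r //.
by rewrite mulr1 mulr_natl mulr2n addrK.
Qed.

Lemma quaternion_double_embedding :
  unital_embedding (@octonion_dot R) (@octonion_mul R) (octonion_one R)
    (dsum_dot (@quaternion_dot R) (@quaternion_dot R))
    (cayley_dickson_mul (@quaternion_mul R)
       (na_conj (@quaternion_dot R) (quaternion_one R)))
    (quaternion_one R, 0) id.
Proof.
split => //.
by move=> [a b] [c d]; rewrite /cayley_dickson_mul !quaternion_conjE.
Qed.

(** The double of an algebra can only be normed if the algebra is associative,
    and in the octonions [l (i j) = - (l i) j].  Take [x = (i, l (i j))] and
    [y = (j, l)].  The first component of [x y] is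
    [i j - l^* (l (i j)) = 0], and the second is
    [l i + (l (i j)) j^* = l i + ((l i) j) j = 0]. *)
Lemma octonion_double_zero_divisor :
  exists x y : (octonion R * octonion R)%type,
    [/\ x != 0, y != 0 &
    cayley_dickson_mul (@octonion_mul R)
      (na_conj (@octonion_dot R) (octonion_one R)) x y = 0].
Proof.
pose i : octonion R := ((0, 1, 0, 0), (0, 0, 0, 0)).
pose j : octonion R := ((0, 0, 1, 0), (0, 0, 0, 0)).
pose l : octonion R := ((0, 0, 0, 0), (1, 0, 0, 0)).
(* [m = l (i j)], as [(0, 1) (k, 0) = (0, k^* ) = (0, - k)]. *)
pose m : octonion R := ((0, 0, 0, 0), (0, 0, 0, -1)).
exists (i, m), (j, l); split.
- by rewrite !xpair_eqE /= oner_eq0 !andbF.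
- by rewrite !xpair_eqE /= oner_eq0 !andbF.
have imag_conj b c d (q : quaternion R) :
    na_conj (@octonion_dot R) (octonion_one R) ((0, b, c, d), q)
    = - ((0, b, c, d), q).
  apply: na_conj_orthogonal; case: q => [[[e f] g] h].
  rewrite -[LHS]/(0 * 1 + b * 0 + c * 0 + d * 0 + (e * 0 + f * 0 + g * 0 + h * 0)).
  by rewrite !mulr0 mul0r !addr0.
rewrite /cayley_dickson_mul !imag_conj.
congr (_, _, _, _, (_, _, _, _), (_, _, _, _, (_, _, _, _))) => /=;
  by rewrite !(oppr0, mulr0, mul0r, addr0, add0r, mulr1, mul1r, opprK, mulrN, subrr, addNr).
Qed.

Lemma real_line_embedding (W : vectType R) (ip : {dot W for idfun})
    (mul : W -> W -> W) (one : W) : normed_algebra ip mul one ->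
  unital_embedding (@real_dot R) (@real_mul R) (real_one R) ip mul one
    (fun a : R^o => a *: one).
Proof.
move=> na; split.
- by move=> a u v /=; rewrite scalerDl scalerA.
- by move=> u v /=; rewrite dotZl dotZr (na_dot11 na) mulr1.
- by move=> u v /=; rewrite (na_mulZl na) (na_mulZr na) (na_mul1u na) scalerA.
- exact: scale1r.
Qed.

(** * Classification *)

Lemma normed_algebra_classification (W : vectType R) (ip : {dot W for idfun})
    (mul : W -> W -> W) (one : W) : normed_algebra ip mul one ->
     (\dim {:W} = 1%N /\
      exists f : W -> R^o,
        normed_algebra_iso ip mul one
          (@real_dot R) (@real_mul R) (real_one R) f) \/
     (\dim {:W} = 2%N /\
      exists f : W -> Rcomplex R,
        normed_algebra_iso ip mul one
          (@complex_dot R) (@complex_mul R) (complex_one R) f) \/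
     (\dim {:W} = 4%N /\
      exists f : W -> quaternion R,
        normed_algebra_iso ip mul one
          (@quaternion_dot R) (@quaternion_mul R) (quaternion_one R) f) \/
     (\dim {:W} = 8%N /\
      exists f : W -> octonion R,
        normed_algebra_iso ip mul one
          (@octonion_dot R) (@octonion_mul R) (octonion_one R) f).
Proof.
move=> na.
have [[-> ?]|[f1 e1]] := unital_embedding_iso_or_double na (real_line_embedding na).
  by left; rewrite dimvf.
have {}e1 := unital_embedding_comp real_double_embedding e1.
have [[-> ?]|[f2 e2]] := unital_embedding_iso_or_double na e1.
  by right; left; rewrite dimvf.
have {}e2 := unital_embedding_comp complex_double_embedding e2.
have [[-> ?]|[f3 e3]] := unital_embedding_iso_or_double na e2.
  by do 2!right; left; rewrite dimvf.
have {}e3 := unital_embedding_comp quaternion_double_embedding e3.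
have [[-> ?]|[f4 e4]] := unital_embedding_iso_or_double na e3.
  by do 3!right; rewrite dimvf.
(* The double of the octonions would embed in [W], where norms multiply. *)
have [x [y [x0 y0 xy0]]] := octonion_double_zero_divisor.
have pos z : z != 0 -> 0 < ip (f4 z) (f4 z).
  by move=> z0; rewrite (ue_isometry e4); apply: neq0_dnorm_gt0.
have := mulr_gt0 (pos _ x0) (pos _ y0).
by rewrite -(na_dotMM na) -(ue_mul e4) xy0 (linear_map0 (ue_linear e4)) dot0l ltxx.
Qed.

End Classification.

Theorem theorem5p4 (R : realType) :
  (* (i) *)
  (forall (W : vectType R) (ip : {dot W for idfun}) (mul : W -> W -> W) (one : W),
     normed_algebra ip mul one ->
     (forall u v : subvs_of (orthogonal_complement ip one),
        vsval (cross_of_mul mul u v)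
        = mul (vsval u) (vsval v) + ip (vsval u) (vsval v) *: one) /\
     cross_product (sub_dot ip (U := orthogonal_complement ip one))
       (@cross_of_mul R W ip mul one)) /\
  (* (ii) *)
  (forall (V : vectType R) (ip : {dot V for idfun}) (cross : V -> V -> V),
     cross_product ip cross ->
     normed_algebra (dsum_dot (@real_dot R) ip) (mul_of_cross ip cross)
       (one_of_cross V)) /\
  (* from a normed algebra to a cross product and back *)
  (forall (W : vectType R) (ip : {dot W for idfun}) (mul : W -> W -> W) (one : W),
     normed_algebra ip mul one ->
     let V : vectType R := subvs_of (orthogonal_complement ip one) in
     let ipV : {dot V for idfun} := sub_dot ip (U := orthogonal_complement ip one) in
     normed_algebra_iso
       (dsum_dot (@real_dot R) ipV)
       (mul_of_cross ipV (@cross_of_mul R W ip mul one))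
       (one_of_cross V)
       ip mul one
       (fun x : (R^o * V)%type => x.1 *: one + vsval x.2)) /\
  (* from a cross product to a normed algebra and back *)
  (forall (V : vectType R) (ip : {dot V for idfun}) (cross : V -> V -> V),
     cross_product ip cross ->
     let W : vectType R := (R^o * V)%type in
     let ipW : {dot W for idfun} := dsum_dot (@real_dot R) ip in
     let one : W := one_of_cross V in
     let iota : V -> subvs_of (orthogonal_complement ipW one) :=
       fun v => vsproj _ ((0, v) : W) in
     (forall v : V, vsval (iota v) = (0, v)) /\
     cross_product_iso
       ip cross
       (sub_dot ipW (U := orthogonal_complement ipW one))
       (@cross_of_mul R W ipW (mul_of_cross ip cross) one)
       iota) /\
  (* classification *)
  (forall (W : vectType R) (ip : {dot W for idfun}) (mul : W -> W -> W) (one : W),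
     normed_algebra ip mul one ->
     (\dim {:W} = 1%N /\
      exists f : W -> R^o,
        normed_algebra_iso ip mul one
          (@real_dot R) (@real_mul R) (real_one R) f) \/
     (\dim {:W} = 2%N /\
      exists f : W -> Rcomplex R,
        normed_algebra_iso ip mul one
          (@complex_dot R) (@complex_mul R) (complex_one R) f) \/
     (\dim {:W} = 4%N /\
      exists f : W -> quaternion R,
        normed_algebra_iso ip mul one
          (@quaternion_dot R) (@quaternion_mul R) (quaternion_one R) f) \/
     (\dim {:W} = 8%N /\
      exists f : W -> octonion R,
        normed_algebra_iso ip mul one
          (@octonion_dot R) (@octonion_mul R) (octonion_one R) f)).
Proof.
split; first by move=> W ip mul one na; split;
  [exact: cross_of_mulE | exact: cross_of_mul_cross_product].
split; first by move=> V ip cross; apply: mul_of_cross_normed_algebra.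
split; first by move=> W ip mul one; apply: algebra_of_cross_of_mul_iso.
split; first by move=> V ip cross cp; split;
  [exact: vsval_iota | exact: cross_of_mul_of_cross_iso].
by move=> W ip mul one; apply: normed_algebra_classification.
Qed.
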